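(* Let $m,n\ge 2$ and let $\Psi=(\Psi_{i_1\cdots i_m})$ be an $m$-order $n$-dimensional real symmetric tensor. Then $Q(\Psi)\ge Z(\Psi)$, where $Q(\Psi)$ is the entanglement eigenvalue and $Z(\Psi)$ is the Z-spectral radius of $\Psi$. Moreover, $Q(\Psi)=Z(\Psi)$ holds in each of the following six cases: 1) $m=2$; 2) $\Psi$ is diagonal, i.e. $\Psi_{i_1\cdots i_m}=0$ unless $i_1=\cdots=i_m$; 3) $\Psi$ is nonnegative (all entries are $\ge 0$); 4) $\Psi$ is nonpositive (all entries are $\le 0$); 5) $\Psi=\sum_{k=1}^n\alpha_k\,(y^{(k)})^{m}$, where $\alpha_1,\dots,\alpha_n$ are real numbers, $\{y^{(k)}:k=1,\dots,n\}$ is an orthonormal basis of $\mathbb{R}^n$, and $(y^{(k)})^m$ denotes the rank-one tensor with entries $y^{(k)}_{i_1}\cdots y^{(k)}_{i_m}$; 6) $m\ge 4$ is even; an entry $\Psi_{i_1\cdots i_m}$ is nonzero only if one half of its indices are equal to each other and the other half of its indices are also equal to each other (i.e. there are $j,k\in\{1,\dots,n\}$, possibly equal, such that $m/2$ of the indices equal $j$ and the remaining $m/2$ equal $k$); and $\Psi$ is diagonally dominated in the sense that the absolute value of each diagonal entry $\Psi_{j\cdots j}$ is greater than or equal to $\binom{m-1}{m/2}$ times the absolute value of any off-diagonal entry whose indices overlap with those of that diagonal entry, i.e. $|\Psi_{j\cdots j}|\ge\binom{m-1}{m/2}\,|\Psi_{i_1\cdots i_m}|$ for every $j$ and every off-diagonal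 entry $\Psi_{i_1\cdots i_m}$ with $j\in\{i_1,\dots,i_m\}$.
   Context: An $m$-order $n$-dimensional tensor is an array $\Psi=(\Psi_{i_1\cdots i_m})$ with $i_1,\dots,i_m\in\{1,\dots,n\}$; it is symmetric if its entries are invariant under any permutation of the indices. For $z\in\mathbb{C}^n$, $\Psi z^{m-1}\in\mathbb{C}^n$ is the vector with $i$th component $(\Psi z^{m-1})_i=\sum_{i_2,\dots,i_m=1}^n\Psi_{ii_2\cdots i_m}z_{i_2}\cdots z_{i_m}$. A bar denotes complex conjugation. Z-eigenvalue: for a real tensor $\Psi$, a real number $\lambda$ is a Z-eigenvalue of $\Psi$ with Z-eigenvector $w\in\mathbb{R}^n$ if $\Psi w^{m-1}=\lambda w$ and $w^\top w=1$. A real symmetric tensor always has Z-eigenvalues; the Z-spectral radius $Z(\Psi)$ is the largest absolute value of the Z-eigenvalues of $\Psi$. Q-eigenvalue (quantum eigenvalue): for a symmetric (complex, in particular real) tensor $\Psi$, $\lambda$ is a Q-eigenvalue of $\Psi$ with Q-eigenvector $z\in\mathbb{C}^n$ if $\Psi z^{m-1}=\lambda\bar z$, $\bar\Psi\bar z^{m-1}=\lambda z$ and $\bar z^\top z=1$. Such $\lambda$ is necessarily real; equivalently, $\lambda\in\mathbb{R}$, $\Psi z^{m-1}=\lambda\bar z$ and $\bar z^\top z=1$. Q-eigenvalues always exist; the largest Q-eigenvalue of $\Psi$ is called the entanglement eigenvalue of $\Psi$ and is denoted $Q(\Psi)$. *)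

(* Defs.v *)
From HB Require Import structures.
From mathcomp Require Import all_boot all_order all_algebra all_fingroup.
From mathcomp Require Import complex.
From mathcomp Require Import all_classical all_reals.

Set Implicit Arguments.
Unset Strict Implicit.
Unset Printing Implicit Defensive.

Import Order.TTheory GRing.Theory Num.Theory.

Local Open Scope classical_set_scope.
Local Open Scope ring_scope.

(* Indices run over 'I_n, i.e. {0, ..., n-1} instead of {1, ..., n}. *)
Definition tensor (K : Type) (m n : nat) := m.-tuple 'I_n -> K.

Definition tensor_symmetric (K : Type) (m n : nat) (Psi : tensor K m n) : Prop :=
  forall (s : 'S_m) (t : m.-tuple 'I_n),
    Psi [tuple tnth t (s i) | i < m] = Psi t.

(* The vector Psi z^(m-1): its i-th entry sums over the multi-indices
   t = (i, i_2, ..., i_m), so that behead t is (i_2, ..., i_m). *)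
Definition tensor_apply (K : comNzRingType) (m n : nat)
    (Psi : tensor K m n) (z : 'cV[K]_n) : 'cV[K]_n :=
  \col_i \sum_(t : m.-tuple 'I_n | ohead t == Some i)
            Psi t * \prod_(j <- behead t) z j 0.

(* The largest element of S; it is 0 by convention if S has no largest
   element. *)
Definition largest (R : realType) (S : set R) : R :=
  xget 0 (S `&` ubound S).

Definition Z_eigenvalue (R : realType) (m n : nat) (Psi : tensor R m n)
    (lam : R) : Prop :=
  exists w : 'cV[R]_n,
    tensor_apply Psi w = lam *: w /\ w^T *m w = 1%:M.

Definition Z_spectral_radius (R : realType) (m n : nat) (Psi : tensor R m n)
    : R :=
  largest [set `|lam| | lam in Z_eigenvalue Psi].

Definition Q_eigenvalue (R : realType) (m n : nat) (Psi : tensor R[i] m n)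
    (lam : R[i]) : Prop :=
  exists z : 'cV[R[i]]_n,
    let zbar := map_mx Num.conj z in
    [/\ tensor_apply Psi z = lam *: zbar,
        tensor_apply (fun t => Num.conj (Psi t)) zbar = lam *: z &
        zbar^T *m z = 1%:M].

(* Q-eigenvalues of a symmetric tensor are real numbers, so that comparing
   the real ones loses nothing. *)
Definition entanglement_eigenvalue (R : realType) (m n : nat)
    (Psi : tensor R[i] m n) : R :=
  largest [set lam : R | Q_eigenvalue Psi (real_complex R lam)].

Definition complex_tensor (R : realType) (m n : nat) (Psi : tensor R m n)
    : tensor R[i] m n :=
  fun t => real_complex R (Psi t).

Definition tensor_diagonal (R : realType) (m n : nat) (Psi : tensor R m n)
    : Prop :=
  forall t : m.-tuple 'I_n, ~~ constant t -> Psi t = 0.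

Definition tensor_nonneg (R : realType) (m n : nat) (Psi : tensor R m n)
    : Prop :=
  forall t, 0 <= Psi t.

Definition tensor_nonpos (R : realType) (m n : nat) (Psi : tensor R m n)
    : Prop :=
  forall t, Psi t <= 0.

Definition rank_one (R : realType) (m n : nat) (y : 'cV[R]_n)
    : tensor R m n :=
  fun t => \prod_(i <- t) y i 0.

(* n orthonormal vectors of R^n automatically form a basis. *)
Definition orthonormal_basis (R : realType) (n : nat) (y : 'I_n -> 'cV[R]_n)
    : Prop :=
  forall k l, (y k)^T *m y l = (k == l)%:R%:M.

Definition orthogonally_decomposable (R : realType) (m n : nat)
    (Psi : tensor R m n) : Prop :=
  exists (alpha : 'I_n -> R) (y : 'I_n -> 'cV[R]_n),
    orthonormal_basis y /\
    forall t, Psi t = \sum_(k < n) alpha k * rank_one (y k) t.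

Definition half_half_supported (R : realType) (m n : nat)
    (Psi : tensor R m n) : Prop :=
  forall t : m.-tuple 'I_n, Psi t != 0 ->
    exists j k : 'I_n, perm_eq t (nseq m./2 j ++ nseq m./2 k).

Definition diagonally_dominated (R : realType) (m n : nat)
    (Psi : tensor R m n) : Prop :=
  forall (j : 'I_n) (t : m.-tuple 'I_n), ~~ constant t -> j \in t ->
    'C(m.-1, m./2)%:R * `|Psi t| <= `|Psi [tuple of nseq m j]|.

(* Main.v *)
Require Import Defs.
From HB Require Import structures.
From mathcomp Require Import all_boot all_order all_algebra all_fingroup.
From mathcomp Require Import complex polyrcf ring lra.
From mathcomp Require Import all_classical all_reals.
From mathcomp Require Import topology normedtype derive.

Set Implicit Arguments.
Unset Strict Implicit.
Unset Printing Implicit Defensive.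

Import Order.TTheory GRing.Theory Num.Theory.
Import numFieldNormedType.Exports.

Local Open Scope ring_scope.
Local Open Scope complex_scope.

Local Notation toC := (map_mx (real_complex _)).

(** Write [F z] for the form [Psi z^m].  By compactness [Re F] attains its maximum
    on the complex unit sphere, and likewise on its real points.  Since
    [F (z + x h)] is a polynomial in the real parameter [x] whose linear coefficient
    is [m <Psi z^(m-1), h>], a maximizer is an eigenvector whose eigenvalue is the
    maximum.  Hence [Q] is the maximum of [Re F] over complex unit vectors and [Z]
    the maximum of [|F|] over real ones; a phase [om] with [om^m = -1] gives
    [Z <= Q].  For equality one bounds [Re F z] by [Z] on complex unit vectors:
    - for [m = 2], [Re F (x + iy) = F x - F y];
    - for entries of constant sign, [|F z| <= |F |z||];
    - for [Psi = \sum_k alpha_k y_k^m], [|alpha_k| <= Z] and Parseval's identity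
      give [|F z| <= \sum_k |alpha_k| |<y_k, z>|^m <= Z]; diagonal tensors are the
      case of the standard basis;
    - for half-half supported tensors with [m = 2h], at most [C(m-1, h)] entries
      have first index [j] and [h] indices [k], so domination gives
      [|F z| <= Z (\sum_j |z_j|^h)^2 <= Z]. *)

(** * Symmetric forms and their directional derivatives *)

Definition tensor_form (K : comNzRingType) (m n : nat) (Psi : tensor K m n)
    (z : 'cV[K]_n) : K :=
  \sum_(t : m.-tuple 'I_n) Psi t * \prod_(j <- t) z j 0.

(** Keeping the direction [h] apart from the base point [z] lets one formula serve both for the
    derivative of the form and, at [h = z], for the form itself. *)
Lemma sum_tensor_apply (K : comNzRingType) (m n : nat)
    (Psi : tensor K m.+1 n) (z h : 'cV[K]_n) :
  \sum_i tensor_apply Psi z i 0 * h i 0 =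
  \sum_(t : m.+1.-tuple 'I_n)
     Psi t * (h (thead t) 0 * \prod_(j <- behead t) z j 0).
Proof.
under eq_bigr => i _ do rewrite mxE mulr_suml.
rewrite [RHS](partition_big (fun t : m.+1.-tuple 'I_n => thead t) predT) //=.
apply: eq_bigr => i _; apply: eq_big => [t|t].
  by case/tupleP: t => a t; rewrite theadE.
case/tupleP: t => a t /=; rewrite theadE => /eqP[->].
by rewrite -mulrA [h _ _ * _]mulrC.
Qed.

Lemma tensor_form_apply (K : comNzRingType) (m n : nat)
    (Psi : tensor K m.+1 n) (z : 'cV[K]_n) :
  tensor_form Psi z = \sum_i tensor_apply Psi z i 0 * z i 0.
Proof.
rewrite sum_tensor_apply; apply: eq_bigr => t _.
by case/tupleP: t => a t; rewrite theadE /= big_cons.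
Qed.

Lemma tensor_formZ (K : comNzRingType) (m n : nat) (Psi : tensor K m n)
    (a : K) (z : 'cV[K]_n) :
  tensor_form Psi (a *: z) = a ^+ m * tensor_form Psi z.
Proof.
rewrite mulr_sumr; apply: eq_bigr => t _.
under eq_bigr => j _ do rewrite mxE.
by rewrite big_split /= big_const_seq count_predT size_tuple iter_mulr_1 mulrCA.
Qed.

(** Leibniz rule: a term linear in ['X] takes ['X] from exactly one factor. Since [r] is
    duplicate-free, the condition [k != i] drops that factor only. *)
Lemma coef1_prod_linear (K : comNzRingType) (I : eqType) (r : seq I)
    (a b : I -> K) :
  uniq r ->
  (\prod_(i <- r) ((a i)%:P + b i *: 'X))`_1 =
  \sum_(i <- r) b i * \prod_(k <- r | k != i) a k.
Proof.
have coef0 s : (\prod_(i <- s) ((a i)%:P + b i *: 'X))`_0 = \prod_(i <- s) a i.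
  rewrite -horner_coef0 horner_prod; apply: eq_bigr => i _.
  by rewrite !hornerE ?mulr0 ?addr0.
elim: r => [_|i r IH /= /andP[ir ur]]; first by rewrite !big_nil coef1.
rewrite !big_cons eqxx mulrDl coefD coefCM -scalerAl coefZ coefXM /= coef0 IH //.
rewrite addrC; congr (b i * _ + _).
  rewrite big_seq_cond [RHS]big_seq_cond; apply: eq_bigl => k.
  by rewrite andbT; case: (boolP (k \in r)) => //= kr; case: eqP kr ir => // -> ->.
rewrite mulr_sumr [RHS]big_seq big_seq; apply: eq_bigr => k kr.
have ik : i != k by apply: contraNneq ir => ->.
by rewrite big_cons ik; exact: mulrCA.
Qed.

(** The Leibniz rule gives one term for each position at which [h] replaces [z]. By symmetry of
    [Psi] that position can be moved to the head, so the [m.+1] terms agree. *)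
Lemma coef1_tensor_line (K : comNzRingType) (m n : nat)
    (Psi : tensor K m.+1 n) (z h : 'cV[K]_n) :
  tensor_symmetric Psi ->
  (\sum_t (Psi t)%:P * \prod_(j <- t) ((z j 0)%:P + h j 0 *: 'X))`_1 =
  (\sum_i tensor_apply Psi z i 0 * h i 0) *+ m.+1.
Proof.
move=> symPsi; rewrite sum_tensor_apply coef_sum.
pose G i (t : m.+1.-tuple 'I_n) :=
  Psi t * (h (tnth t i) 0 * \prod_(k < m.+1 | k != i) z (tnth t k) 0).
transitivity (\sum_(i < m.+1) \sum_t G i t).
  rewrite exchange_big; apply: eq_bigr => t _.
  rewrite coefCM big_tuple coef1_prod_linear ?index_enum_uniq //.
  by rewrite mulr_sumr.
rewrite -[X in _ *+ X]card_ord -sumr_const; apply: eq_bigr => i _.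
(* Exchanging positions [0] and [i] is a bijection of the index tuples that leaves [Psi]
   unchanged. *)
pose f (t : m.+1.-tuple 'I_n) := [tuple tnth t (tperm ord0 i k) | k < m.+1].
have fK : involutive f.
  by move=> t; apply: eq_from_tnth => k; rewrite !tnth_mktuple tpermK.
rewrite (reindex_inj (inv_inj fK)); apply: eq_bigr => t _.
rewrite /G symPsi tnth_mktuple tpermR; congr (_ * (_ * _)).
rewrite (reindex_inj (@perm_inj _ (tperm ord0 i))) /=.
transitivity (\prod_(k < m.+1 | k != ord0) z (tnth t k) 0).
  apply: eq_big => k; last by rewrite tnth_mktuple tpermK.
  by rewrite -(inj_eq (@perm_inj _ (tperm ord0 i)) k) tpermL.
rewrite (big_tuple _ _ (behead_tuple t)) big_mkcond big_ord_recl /= mul1r.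
apply: eq_bigr => k _; rewrite tnth_behead; congr (z (tnth t _) 0).
by apply: val_inj; rewrite /= /bump inordK ?ltnS // add1n.
Qed.

Lemma horner_tensor_line (K : comNzRingType) (m n : nat)
    (Psi : tensor K m n) (z h : 'cV[K]_n) (x : K) :
  (\sum_t (Psi t)%:P * \prod_(j <- t) ((z j 0)%:P + h j 0 *: 'X)).[x] =
  tensor_form Psi (z + x *: h).
Proof.
rewrite horner_sum; apply: eq_bigr => t _.
rewrite hornerM hornerC horner_prod; congr (_ * _); apply: eq_bigr => j _.
by rewrite !hornerE !mxE mulrC.
Qed.

(** * First-order conditions on the complex unit sphere *)

(** Write [r = s * 'X]. If [s.[0]] were nonzero, [s] would keep its sign near [0] while ['X] changes
    sign, so [r] would be negative on one side. *)
Lemma coef1_nneg_poly (R : rcfType) (r : {poly R}) :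
  (forall x, 0 <= r.[x]) -> r.[0] = 0 -> r`_1 = 0.
Proof.
move=> r_ge0 r0.
have /factor_theorem[s rE] : root r 0 by rewrite rootE r0.
rewrite subr0 in rE; rewrite rE coefMX /=.
rewrite -horner_coef0; apply/eqP/contraT => s0; have := s0.
rewrite -normr_gt0 => /(poly_cont 0 s)[d d_gt0 sd].
have r_at x : 0 <= s.[x] * x by rewrite -[X in _ * X]hornerX -hornerM -rE.
have dN : `|- (d / 2) - 0| < d by rewrite subr0 normrN gtr0_norm; lra.
have dP : `|d / 2 - 0| < d by rewrite subr0 gtr0_norm; lra.
case: (ltrgtP s.[0] 0) s0 => // s0 _.
  move: (sd _ dP) (r_at (d / 2)); rewrite (ltr0_norm s0) ltr_norml => /andP[_].
  by move=> ? ?; nra.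
move: (sd _ dN) (r_at (- (d / 2))); rewrite (gtr0_norm s0) ltr_norml => /andP[].
by move=> ? _ ?; nra.
Qed.

Lemma complexReM (R : rcfType) (x y : R[i]) :
  complex.Re (x * y) = complex.Re x * complex.Re y - complex.Im x * complex.Im y.
Proof. by case: x y => [a b] [c d]. Qed.

Lemma complexReMr (R : rcfType) (x : R[i]) (y : R) :
  complex.Re (x * y%:C) = complex.Re x * y.
Proof. by rewrite complexReM /= mulr0 subr0. Qed.

Lemma complexReMl (R : rcfType) (x : R) (y : R[i]) :
  complex.Re (x%:C * y) = x * complex.Re y.
Proof. by rewrite mulrC complexReMr mulrC. Qed.

Lemma complexRe_sum (R : rcfType) (I : Type) (r : seq I) (P : pred I) (F : I -> R[i]) :
  complex.Re (\sum_(i <- r | P i) F i) = \sum_(i <- r | P i) complex.Re (F i).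
Proof. exact: raddf_sum. Qed.

Lemma horner_map_Re (R : rcfType) (p : {poly R[i]}) (x : R) :
  (map_poly (@complex.Re R) p).[x] = complex.Re p.[x%:C].
Proof.
rewrite horner_poly horner_coef complexRe_sum; apply: eq_bigr => i _.
by rewrite -rmorphXn /= complexReMr.
Qed.

(** The squared Hermitian norm, with values in [R] rather than [R[i]] so that it can be ordered,
    rooted and tested for continuity over the reals. *)
Definition sqnorm (R : rcfType) (n : nat) (z : 'cV[R[i]]_n) : R :=
  \sum_j (complex.Re (z j 0) ^+ 2 + complex.Im (z j 0) ^+ 2).

Lemma sqnorm_ge0 (R : rcfType) (n : nat) (z : 'cV[R[i]]_n) : 0 <= sqnorm z.
Proof. by apply: sumr_ge0 => j _; rewrite addr_ge0 ?sqr_ge0. Qed.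

Lemma sqnormE (R : rcfType) (n : nat) (z : 'cV[R[i]]_n) :
  (sqnorm z)%:C = \sum_j `|z j 0| ^+ 2.
Proof. by rewrite rmorph_sum; apply: eq_bigr => j _; rewrite -add_Re2_Im2. Qed.

Lemma sqnorm_unit (R : rcfType) (n : nat) (z : 'cV[R[i]]_n) :
  ((map_mx Num.conj z)^T *m z = 1%:M) <-> (sqnorm z = 1).
Proof.
have zE : (map_mx Num.conj z)^T *m z = (sqnorm z)%:C%:M.
  apply/matrixP => i j; rewrite !ord1 !mxE sqnormE /= mulr1n.
  by apply: eq_bigr => k _; rewrite !mxE normCK mulrC.
rewrite zE; split=> [/matrixP/(_ 0 0)|->//].
by rewrite !mxE /= !mulr1n => -[].
Qed.

Lemma sqnorm_scale (R : rcfType) (n : nat) (a : R) (z : 'cV[R[i]]_n) :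
  sqnorm (a%:C *: z) = a ^+ 2 * sqnorm z.
Proof.
rewrite mulr_sumr; apply: eq_bigr => j _; rewrite mxE.
by case: (z j 0) => x y /=; ring.
Qed.

(** Pythagoras: the cross term is [2 * x] times the real part assumed to vanish. *)
Lemma sqnorm_line (R : rcfType) (n : nat) (z h : 'cV[R[i]]_n) (x : R) :
  complex.Re (\sum_j Num.conj (z j 0) * h j 0) = 0 ->
  sqnorm (x%:C *: h + z) = sqnorm z + x ^+ 2 * sqnorm h.
Proof.
rewrite complexRe_sum => zh.
rewrite -[RHS]addr0 -[0 in RHS](mulr0 (2 * x)) -zh !mulr_sumr -!big_split /=.
apply: eq_bigr => j _; rewrite !mxE.
by case: (z j 0) (h j 0) => a b [c d] /=; ring.
Qed.

Lemma coef1_sphere_line (R : comNzRingType) (c : R) (m : nat) :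
  ((1 + c *: 'X ^+ 2) ^+ m)`_1 = 0.
Proof.
have := coef_deriv ((1 + c *: 'X ^+ 2) ^+ m) 0; rewrite mulr1n => <-.
rewrite -horner_coef0 deriv_exp derivD derivZ derivXn derivC.
rewrite add0r !(hornerMn, hornerM, hornerZ, hornerXn) expr1 mul0rn.
by rewrite mulr0 mul0r mul0rn.
Qed.

(** Homogeneity under positive real scaling. The bound is assumed only on real multiples of [v], so
    that it remains available inside a real subspace. *)
Lemma Re_tensor_form_le (R : rcfType) (m n : nat) (Psi : tensor R[i] m n)
    (M : R) (v : 'cV[R[i]]_n) :
  0 < sqnorm v ->
  (forall a : R, sqnorm (a%:C *: v) = 1 ->
     complex.Re (tensor_form Psi (a%:C *: v)) <= M) ->
  complex.Re (tensor_form Psi v) <= M * Num.sqrt (sqnorm v) ^+ m.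
Proof.
move=> v_gt0 maxM; set s := Num.sqrt _.
have s_gt0 : 0 < s by rewrite sqrtr_gt0.
have /maxM : sqnorm (s^-1%:C *: v) = 1.
  rewrite sqnorm_scale -[sqnorm v]sqr_sqrtr ?(ltW v_gt0) //.
  by rewrite -exprMn mulVf ?expr1n // gt_eqF.
rewrite tensor_formZ -rmorphXn /= complexReMl exprVn mulrC.
by rewrite ler_pdivrMr // exprn_gt0.
Qed.

(** The vector [h] is the conjugate of the residual of the claimed equation. The squared norm of the
    residual is a real combination of the two pairings with [h], hence zero. *)
Lemma conj_residual (R : rcfType) (n : nat) (g z : 'cV[R[i]]_n) (M : R) :
  let h := (- M)%:C *: z + map_mx Num.conj g in
  complex.Re (\sum_j g j 0 * h j 0) = 0 ->
  complex.Re (\sum_j Num.conj (z j 0) * h j 0) = 0 ->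
  g = M%:C *: map_mx Num.conj z.
Proof.
move=> h gh zh; pose d := g - M%:C *: map_mx Num.conj z.
have hE j : h j 0 = Num.conj (d j 0).
  rewrite !mxE rmorphB rmorphM /= conjCK (conjc_real M : Num.conj M%:C = _).
  by rewrite rmorphN mulNr addrC.
have : (sqnorm d)%:C = \sum_j g j 0 * h j 0 - M%:C * \sum_j Num.conj (z j 0) * h j 0.
  rewrite sqnormE mulr_sumr -sumrB; apply: eq_bigr => j _.
  by rewrite normCK -hE !mxE; ring.
move/(congr1 (@complex.Re R)); rewrite raddfB /= complexReMl gh zh mulr0 subr0 => /eqP.
rewrite psumr_eq0 => [/allP d0|j _]; last by rewrite addr_ge0 ?sqr_ge0.
apply/eqP; rewrite -subr_eq0; apply/eqP/colP => j; rewrite -/d [RHS]mxE.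
have := d0 j (mem_index_enum j); rewrite /= paddr_eq0 ?sqr_ge0 // !sqrf_eq0.
by case: (d j 0) => x y /= /andP[/eqP-> /eqP->].
Qed.

(* [D] will be either all complex vectors or the real ones, so that one argument
   yields both Q-eigenvectors and Z-eigenvectors. *)
Lemma critical_point (R : rcfType) (m n : nat) (Psi : tensor R[i] m.+1 n)
    (D : 'cV[R[i]]_n -> Prop) (M : R) (z : 'cV[R[i]]_n) :
  tensor_symmetric Psi ->
  (forall (a : R) u v, D u -> D v -> D (a%:C *: u + v)) ->
  D z -> D (map_mx Num.conj (tensor_apply Psi z)) ->
  sqnorm z = 1 -> complex.Re (tensor_form Psi z) = M ->
  (forall v, D v -> sqnorm v = 1 -> complex.Re (tensor_form Psi v) <= M) ->
  tensor_apply Psi z = M%:C *: map_mx Num.conj z.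
Proof.
move=> symPsi Dlin Dz Dg z1 zM maxM.
set g := tensor_apply Psi z in Dg *.
pose h := (- M)%:C *: z + map_mx Num.conj g.
have Dh : D h by exact: Dlin.
(* The zero vector lies in [D] because it is [(-1) *: v + v]. *)
have Dscale (a : R) v : D v -> D (a%:C *: v).
  move=> Dv; rewrite -[_ *: v]addr0; apply: (Dlin) => //.
  by rewrite -(addNr v) -scaleN1r -(rmorphN1 (real_complex R)); exact: Dlin.
(* The residual is tangent to the sphere: the pairing is [- M * sqnorm z] plus the conjugate of the
   form at [z], with real part [- M + M]. *)
have zh : complex.Re (\sum_j Num.conj (z j 0) * h j 0) = 0.
  transitivity (complex.Re (- M%:C * (sqnorm z)%:C + Num.conj (tensor_form Psi z))).
    rewrite sqnormE tensor_form_apply mulr_sumr rmorph_sum -big_split /=.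
    congr complex.Re.
    by apply: eq_bigr => j _; rewrite !mxE normCK rmorphM rmorphN; ring.
  by rewrite z1 mulr1 -zM; case: (tensor_form Psi z) => x y /=; rewrite addNr.
(* [M] may be negative, so the homogeneous bound [M |z + x h|^m] is weakened to
   [M + |M| (|z + x h|^(2m) - 1)], which is polynomial in [x] and flat at [0]. *)
pose p := \sum_t (Psi t)%:P * \prod_(j <- t) ((z j 0)%:P + h j 0 *: 'X).
pose r := (M - `|M|)%:P + `|M| *: (1 + sqnorm h *: 'X ^+ 2) ^+ m.+1
          - map_poly (@complex.Re R) p.
have rE x : r.[x] = M - `|M| + `|M| * (1 + x ^+ 2 * sqnorm h) ^+ m.+1
                    - complex.Re (tensor_form Psi (x%:C *: h + z)).
  rewrite hornerD hornerN horner_map_Re horner_tensor_line [z + _]addrC.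
  rewrite hornerD hornerC hornerZ horner_exp hornerD hornerC hornerZ hornerXn.
  rewrite [sqnorm h * _]mulrC; reflexivity.
have r_ge0 x : 0 <= r.[x].
  have nE : sqnorm (x%:C *: h + z) = 1 + x ^+ 2 * sqnorm h.
    by rewrite sqnorm_line ?zh // z1.
  have n_ge1 : 1 <= sqnorm (x%:C *: h + z).
    by rewrite nE lerDl mulr_ge0 ?sqr_ge0 ?sqnorm_ge0.
  have n_gt0 := lt_le_trans ltr01 n_ge1.
  rewrite rE -nE subr_ge0.
  have /le_trans-> // : complex.Re (tensor_form Psi (x%:C *: h + z)) <=
      M * Num.sqrt (sqnorm (x%:C *: h + z)) ^+ m.+1.
    by apply: Re_tensor_form_le => // a; apply: maxM; apply/Dscale/Dlin.
  set s := Num.sqrt _; rewrite -(sqr_sqrtr (ltW n_gt0)) -/s -exprM mulnC exprM.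
  have : 1 <= s ^+ m.+1.
    by apply: exprn_ege1; rewrite /s -[1]sqrtr1 ler_sqrt ?sqnorm_ge0.
  move: (s ^+ m.+1) => a a_ge1.
  (* This product is exactly [M - |M| + |M| a^2 - M a], the gap between the weakened and the
     homogeneous bound. *)
  have : 0 <= (a - 1) * (`|M| * a + (`|M| - M)).
    have a_ge0 := le_trans ler01 a_ge1.
    by rewrite mulr_ge0 ?subr_ge0 // addr_ge0 ?mulr_ge0 // subr_ge0 ler_norm.
  nra.
have r0 : r.[0] = 0.
  rewrite rE scale0r add0r zM /= expr0n mul0r addr0 expr1n; ring.
have := coef1_nneg_poly r_ge0 r0.
(* The flat majorant has no linear term, so only the coefficient of [p] survives: [m.+1] times the
   pairing of [g] with [h] has real part zero. *)
rewrite coefB coefD coefC coefZ coef1_sphere_line mulr0 addr0 sub0r coef_map_id0 //.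
rewrite coef1_tensor_line // -mulr_natr -(rmorph_nat (real_complex R)) complexReMr.
move=> /eqP; rewrite oppr_eq0 mulf_eq0 pnatr_eq0 orbF -/g => /eqP gh.
by apply: conj_residual zh.
Qed.

(** * Compactness and existence of maximizers *)

(** Continuity is stated componentwise, so that only the topology of [R] is involved. *)
Definition continuousC (T : topologicalType) (R : realType) (f : T -> R[i]) :=
  continuous (fun x => complex.Re (f x)) /\ continuous (fun x => complex.Im (f x)).

Lemma continuousC_cst (T : topologicalType) (R : realType) (a : R[i]) :
  continuousC (fun _ : T => a).
Proof. by split=> x; exact: cvg_cst. Qed.

Lemma continuousCD (T : topologicalType) (R : realType) (f g : T -> R[i]) :
  continuousC f -> continuousC g -> continuousC (fun x => f x + g x).
Proof.
move=> [fr fi] [gr gi]; split=> x.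
  under eq_fun do rewrite raddfD.
  by apply: cvgD; [exact: fr|exact: gr].
under eq_fun do rewrite raddfD.
by apply: cvgD; [exact: fi|exact: gi].
Qed.

Lemma continuousCM (T : topologicalType) (R : realType) (f g : T -> R[i]) :
  continuousC f -> continuousC g -> continuousC (fun x => f x * g x).
Proof.
move=> [fr fi] [gr gi]; split=> x.
  under eq_fun do rewrite complexReM.
  by apply: cvgB; apply: cvgM; [exact: fr|exact: gr|exact: fi|exact: gi].
have ImM (u v : R[i]) : complex.Im (u * v) =
    complex.Re u * complex.Im v + complex.Im u * complex.Re v.
  by case: u v => [a b] [c d].
under eq_fun do rewrite ImM.
by apply: cvgD; apply: cvgM; [exact: fr|exact: gi|exact: fi|exact: gr].
Qed.

Lemma continuousC_big (T : topologicalType) (R : realType) (I : Type)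
    (op : R[i] -> R[i] -> R[i]) (e : R[i]) (s : seq I) (P : pred I)
    (f : I -> T -> R[i]) :
  (forall g h : T -> R[i], continuousC g -> continuousC h ->
     continuousC (fun x => op (g x) (h x))) ->
  (forall i, continuousC (f i)) ->
  continuousC (fun x => \big[op/e]_(i <- s | P i) f i x).
Proof.
move=> cop cf; elim: s => [|i s IH].
  under eq_fun do rewrite big_nil.
  exact: continuousC_cst.
under eq_fun do rewrite big_cons.
by case: (P i) => //; exact: cop.
Qed.

Lemma continuousC_tensor_form (T : topologicalType) (R : realType) (m n : nat)
    (Psi : tensor R[i] m n) (z : T -> 'cV[R[i]]_n) :
  (forall j, continuousC (fun x => z x j 0)) ->
  continuousC (fun x => tensor_form Psi (z x)).
Proof.
move=> cz; apply: continuousC_big => [|t]; first exact: continuousCD.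
apply: continuousCM; first exact: continuousC_cst.
by apply: continuousC_big => //; exact: continuousCM.
Qed.

Lemma continuous_sum_sqr (T : topologicalType) (R : realType) (I : finType)
    (f : I -> T -> R) :
  (forall i, continuous (f i)) -> continuous (fun x => \sum_i f i x ^+ 2).
Proof.
move=> cf; apply: continuous_big => [|i _ x]; first exact: add_continuous.
by under eq_fun do rewrite expr2; apply: cvgM; exact: cf.
Qed.

Lemma continuous_sqnorm (T : topologicalType) (R : realType) (n : nat)
    (z : T -> 'cV[R[i]]_n) :
  (forall j, continuousC (fun x => z x j 0)) -> continuous (fun x => sqnorm (z x)).
Proof.
move=> cz; apply: continuous_big => [|j _ x]; first exact: add_continuous.
under eq_fun do rewrite !expr2.
case: (cz j) => cr ci.
by apply: cvgD; apply: cvgM; [exact: cr|exact: cr|exact: ci|exact: ci].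
Qed.

(** Complex vectors are encoded as real rows of twice the length. The sphere, cut by the real
    subspace when [b] holds, becomes a closed bounded set, to which the extreme value theorem
    applies. *)
Lemma sphere_max (R : realType) (m n : nat) (Psi : tensor R[i] m n.+1) (b : bool) :
  let D (v : 'cV[R[i]]_n.+1) := b -> forall j, complex.Im (v j 0) = 0 in
  exists z : 'cV[R[i]]_n.+1, [/\ D z, sqnorm z = 1 &
    forall v, D v -> sqnorm v = 1 ->
      complex.Re (tensor_form Psi v) <= complex.Re (tensor_form Psi z)].
Proof.
move=> D; pose N := (n.+1 + n.+1)%N.
pose Z (p : 'rV[R]_N) : 'cV[R[i]]_n.+1 :=
  \col_j (p 0 (lshift _ j) +i* p 0 (rshift _ j)).
pose U (v : 'cV[R[i]]_n.+1) : 'rV[R]_N :=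
  row_mx (\row_j complex.Re (v j 0)) (\row_j complex.Im (v j 0)).
have UK v : Z (U v) = v.
  apply/colP => j; rewrite mxE row_mxEl row_mxEr !mxE.
  by case: (v j 0).
(* Reality of the vector is a single polynomial equation that is trivial for [b = false], so both
   cases share one proof of closedness. *)
pose A := [set p : 'rV[R]_N | sqnorm (Z p) = 1 /\
  \sum_j (b%:R * p 0 (rshift n.+1 j)) ^+ 2 = 0]%classic.
have AE p : A p <-> sqnorm (Z p) = 1 /\ D (Z p).
  rewrite /A /=; split=> -[p1 pD]; split=> //.
    move=> bT j; rewrite mxE /=; move: pD => /eqP; rewrite psumr_eq0 => [|k _].
      by move=> /allP /(_ j (mem_index_enum j)) /=; rewrite bT mul1r sqrf_eq0 => /eqP.
    exact: sqr_ge0.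
  apply: big1 => j _; case: b @D pD {A} => D pD; last by rewrite mul0r expr0n.
  by have := pD isT j; rewrite mxE /= => ->; rewrite mulr0 expr0n.
have cp k : continuous (fun p : 'rV[R]_N => p 0 k) by exact: coord_continuous.
have cZj j : continuousC (fun p => Z p j 0).
  by split; under eq_fun do rewrite mxE; exact: cp.
have cZ : continuous (fun p => complex.Re (tensor_form Psi (Z p))).
  exact: (continuousC_tensor_form _ _).1.
have clA : closed A.
  have cl0 (f : 'rV[R]_N -> R) a : continuous f -> closed [set p | f p = a]%classic.
    move=> cf; apply: (@preimage_closed _ _ f [set a]%classic) => [p _|].
      exact: cf.
    exact: closed_eq.
  apply: closedI; apply: cl0.
    exact: continuous_sqnorm.
  apply: continuous_sum_sqr => j p; apply: continuous_comp; first exact: cp.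
  exact: mulrl_continuous.
(* The square of each real coordinate is a summand of the squared norm, so the maximum norm is at
   most [1]. *)
have bdA : bounded_set A.
  exists 1; split; first exact: num_real.
  move=> M M_gt1 p [p1 _]; rewrite /= /Num.norm /= mx_normrE.
  apply: bigmax_le => [|[i k] _].
    by rewrite (le_trans ler01) // ltW.
  rewrite (le_trans _ (ltW M_gt1)) // ord1 /=.
  rewrite -[leRHS](sqrtr1) -sqrtr_sqr ler_sqrt // -p1 /sqnorm.
  case: (split_ordP (k : 'I_N)) => j ->.
    rewrite (bigD1 j) //= mxE /=; rewrite -addrA lerDl addr_ge0 ?sqr_ge0 //.
    by apply: sumr_ge0 => l _; rewrite addr_ge0 ?sqr_ge0.
  rewrite (bigD1 j) //= mxE /= addrAC lerDr addr_ge0 ?sqr_ge0 //.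
  by apply: sumr_ge0 => l _; rewrite addr_ge0 ?sqr_ge0.
(* A standard basis vector is real, hence admissible for both values of [b]. *)
have A0 : (A !=set0)%classic.
  exists (U (delta_mx 0 0)); apply/AE; rewrite UK; split.
    rewrite /sqnorm (bigD1 0) //= mxE eqxx big1 /= => [|j j0].
      by rewrite expr1n expr0n !addr0.
    by rewrite mxE (negbTE j0) /= expr0n addr0.
  by move=> _ j; rewrite mxE; case: (_ && _).
have [p pA pmax] := EVT_max_rV A0 (bounded_closed_compact bdA clA)
  (continuous_subspaceT cZ).
move: pA; rewrite inE => /AE[p1 pD].
exists (Z p); split=> // v vD v1; have := pmax (U v); rewrite UK; apply.
by rewrite inE; apply/AE; rewrite UK.
Qed.

(** * Q and Z as maxima of the form on unit spheres *)

Lemma largest_eq (R : realType) (S : set R) (M : R) :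
  S M -> ubound S M -> largest S = M.
Proof.
move=> SM ubM; rewrite /largest; case: xgetP => [y _ [Sy uby]|/(_ M)[]//].
by apply/eqP; rewrite eq_le ubM // uby.
Qed.

Lemma complex_tensor_sym (R : realType) (m n : nat) (Psi : tensor R m n) :
  tensor_symmetric Psi -> tensor_symmetric (complex_tensor Psi).
Proof. by move=> symPsi s t; rewrite /complex_tensor symPsi. Qed.

Lemma tensor_form_toC (R : realType) (m n : nat) (Psi : tensor R m n) (w : 'cV[R]_n) :
  tensor_form (complex_tensor Psi) (toC w) = (tensor_form Psi w)%:C.
Proof.
rewrite rmorph_sum; apply: eq_bigr => t _; rewrite rmorphM rmorph_prod.
by congr (_ * _); apply: eq_bigr => j _; rewrite mxE.
Qed.

Lemma tensor_apply_toC (R : realType) (m n : nat) (Psi : tensor R m n) (w : 'cV[R]_n) :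
  tensor_apply (complex_tensor Psi) (toC w) = toC (tensor_apply Psi w).
Proof.
apply/colP => i; rewrite !mxE rmorph_sum; apply: eq_bigr => t _.
by rewrite rmorphM rmorph_prod; congr (_ * _); apply: eq_bigr => j _; rewrite mxE.
Qed.

Lemma sqnorm_toC (R : realType) (n : nat) (w : 'cV[R]_n) :
  sqnorm (toC w) = \sum_j w j 0 ^+ 2.
Proof. by apply: eq_bigr => j _; rewrite mxE /= expr0n addr0. Qed.

Lemma unit_toC (R : realType) (n : nat) (w : 'cV[R]_n) :
  (w^T *m w = 1%:M) <-> (sqnorm (toC w) = 1).
Proof.
have -> : w^T *m w = (sqnorm (toC w))%:M.
  apply/matrixP => i j; rewrite !ord1 sqnorm_toC !mxE mulr1n.
  by apply: eq_bigr => k _; rewrite !mxE expr2.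
split=> [/matrixP/(_ 0 0)|->//].
by rewrite !mxE.
Qed.

Lemma conj_toC (R : realType) (n : nat) (w : 'cV[R]_n) :
  map_mx Num.conj (toC w) = toC w.
Proof. by apply/colP => j; rewrite !mxE; exact: conjc_real. Qed.

Lemma tensor_form_opp (K : comNzRingType) (m n : nat) (Psi : tensor K m n) z :
  tensor_form (fun t => - Psi t) z = - tensor_form Psi z.
Proof. by rewrite -sumrN; apply: eq_bigr => t _; rewrite mulNr. Qed.

Lemma tensor_apply_opp (K : comNzRingType) (m n : nat) (Psi : tensor K m n) z :
  tensor_apply (fun t => - Psi t) z = - tensor_apply Psi z.
Proof.
by apply/colP => i; rewrite !mxE -sumrN; apply: eq_bigr => t _; rewrite mulNr.
Qed.

(** On the real slice, [critical_point] applies because a real tensor sends real vectors to real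
    vectors, which keeps the conjugated gradient in [D]. *)
Lemma tensor_max_critical (R : realType) (m n : nat) (Psi : tensor R m.+1 n.+1)
    (b : bool) :
  tensor_symmetric Psi ->
  let D (v : 'cV[R[i]]_n.+1) := b -> forall j, complex.Im (v j 0) = 0 in
  let F v := complex.Re (tensor_form (complex_tensor Psi) v) in
  exists z : 'cV[R[i]]_n.+1, [/\ D z, sqnorm z = 1,
    tensor_apply (complex_tensor Psi) z = (F z)%:C *: map_mx Num.conj z &
    forall v, D v -> sqnorm v = 1 -> F v <= F z].
Proof.
move=> symPsi D F; have [z [Dz z1 maxz]] := sphere_max (complex_tensor Psi) b.
have toCRe v : D v -> b -> v = toC (map_mx (@complex.Re R) v).
  move=> Dv bT; apply/colP => j; rewrite !mxE.
  by have := Dv bT j; case: (v j 0) => x y /= ->.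
exists z; split=> //; apply: (critical_point (D := D)) => //.
- exact: complex_tensor_sym.
- move=> a u v Du Dv bT j; rewrite !mxE; move: (Du bT j) (Dv bT j).
  by case: (u j 0) (v j 0) => x y [x' y'] /= -> ->; ring.
- move=> bT j; rewrite (toCRe _ Dz bT) tensor_apply_toC conj_toC mxE.
  by rewrite mxE.
Qed.

(** Pairing the eigenvector equation with the eigenvector shows that each eigenvalue is a value of
    [F] on the sphere; conversely the maximizer is an eigenvector for the largest value. *)
Lemma entanglement_max (R : realType) (m n : nat) (Psi : tensor R m.+1 n.+1) :
  tensor_symmetric Psi ->
  let F v := complex.Re (tensor_form (complex_tensor Psi) v) in
  exists z : 'cV[R[i]]_n.+1, [/\ sqnorm z = 1,
    F z = entanglement_eigenvalue (complex_tensor Psi) &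
    forall v, sqnorm v = 1 -> F v <= entanglement_eigenvalue (complex_tensor Psi)].
Proof.
move=> symPsi F; have [z [_ z1 zE zmax]] := tensor_max_critical false symPsi.
have {}zmax v : sqnorm v = 1 -> F v <= F z by exact: zmax.
suff QE : entanglement_eigenvalue (complex_tensor Psi) = F z.
  by exists z; split=> // v v1; rewrite QE; exact: zmax.
apply: largest_eq => [|lam [v [vE _ /sqnorm_unit v1]]].
  exists z; split=> //; last exact/sqnorm_unit.
  (* The entries being real, the second eigenvector equation is the conjugate of the first. *)
  apply/colP => i; move/colP/(_ i)/(congr1 Num.conj): zE.
  rewrite !mxE (rmorphM Num.conj) /= conjCK (conjc_real _ : Num.conj _%:C = _) => <-.
  rewrite rmorph_sum; apply: eq_bigr => t _; rewrite rmorphM rmorph_prod.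
  by congr (_ * _); apply: eq_bigr => j _; rewrite mxE.
suff -> : lam = F v by exact: zmax.
rewrite /F tensor_form_apply vE.
transitivity (complex.Re (lam%:C * (sqnorm v)%:C)); first by rewrite v1 mulr1.
rewrite sqnormE mulr_sumr; congr complex.Re; apply: eq_bigr => j _.
by rewrite !mxE normCK -mulrA [Num.conj _ * _]mulrC.
Qed.

(** Maximizing the forms of [Psi] and of its opposite yields the two extreme values of the form on
    the real sphere, both at Z-eigenvectors. The one larger in absolute value is the spectral
    radius. *)
Lemma Z_spectral_max (R : realType) (m n : nat) (Psi : tensor R m.+1 n.+1) :
  tensor_symmetric Psi ->
  exists w : 'cV[R]_n.+1, [/\ w^T *m w = 1%:M,
    `|tensor_form Psi w| = Z_spectral_radius Psi &
    forall v : 'cV[R]_n.+1, v^T *m v = 1%:M ->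
      `|tensor_form Psi v| <= Z_spectral_radius Psi].
Proof.
have real_max (Phi : tensor R m.+1 n.+1) : tensor_symmetric Phi ->
    exists w : 'cV[R]_n.+1, [/\ w^T *m w = 1%:M,
      tensor_apply Phi w = tensor_form Phi w *: w &
      forall v : 'cV[R]_n.+1, v^T *m v = 1%:M ->
        tensor_form Phi v <= tensor_form Phi w].
  move=> symPhi; have [z [Dz z1 zE zmax]] := tensor_max_critical true symPhi.
  pose w := map_mx (@complex.Re R) z.
  have zw : z = toC w.
    apply/colP => j; rewrite !mxE.
    by have := Dz isT j; case: (z j 0) => x y /= ->.
  exists w; split.
  - by apply/unit_toC; rewrite -zw.
  - apply: (map_mx_inj (f := real_complex R)); rewrite -tensor_apply_toC -zw zE zw.
    by rewrite conj_toC tensor_form_toC map_mxZ.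
  - move=> v /unit_toC v1.
    have := zmax (toC v); rewrite zw !tensor_form_toC; apply=> //.
    by move=> _ j; rewrite mxE.
have eigen_form (lam : R) (w : 'cV[R]_n.+1) : w^T *m w = 1%:M ->
    tensor_apply Psi w = lam *: w -> tensor_form Psi w = lam.
  move=> /unit_toC; rewrite sqnorm_toC => w1 wE.
  rewrite tensor_form_apply wE -[RHS]mulr1 -w1 mulr_sumr.
  by apply: eq_bigr => j _; rewrite mxE -mulrA -expr2.
move=> symPsi.
suff [w [w1 wE wmax]] : exists w : 'cV[R]_n.+1, [/\ w^T *m w = 1%:M,
    tensor_apply Psi w = tensor_form Psi w *: w &
    forall v : 'cV[R]_n.+1, v^T *m v = 1%:M ->
      `|tensor_form Psi v| <= `|tensor_form Psi w|].
  suff ZE : Z_spectral_radius Psi = `|tensor_form Psi w|.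
    by exists w; split=> // v v1; rewrite ZE; exact: wmax.
  apply: largest_eq; first by exists (tensor_form Psi w) => //; exists w.
  by move=> _ [lam [v [vE v1]] <-]; rewrite -(eigen_form _ _ v1 vE); exact: wmax.
have [w [w1 wE wmax]] := real_max _ symPsi.
have [|u [u1 uE umax]] := real_max (fun t => - Psi t).
  by move=> s t; rewrite symPsi.
have {}uE : tensor_apply Psi u = tensor_form Psi u *: u.
  by apply: oppr_inj; rewrite -tensor_apply_opp uE tensor_form_opp scaleNr.
have {}umax v : v^T *m v = 1%:M -> tensor_form Psi u <= tensor_form Psi v.
  by move=> /umax; rewrite !tensor_form_opp lerN2.
have [uw|wu] := leP (- tensor_form Psi u) (tensor_form Psi w).
  exists w; split=> // v v1; have := wmax _ v1; have := umax _ v1 => ? ?.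
  rewrite (le_trans _ (ler_norm _)) // ler_norml; lra.
exists u; split=> // v v1; have := wmax _ v1; have := umax _ v1 => ? ?.
rewrite -normrN -[leRHS]normrN (le_trans _ (ler_norm _)) // normrN ler_norml; lra.
Qed.

Lemma normr_tensor_form_le (R : realType) (m n : nat) (Psi : tensor R m.+1 n.+1)
    (w : 'cV[R]_n.+1) :
  tensor_symmetric Psi ->
  `|tensor_form Psi w| <=
     Z_spectral_radius Psi * Num.sqrt (\sum_j w j 0 ^+ 2) ^+ m.+1.
Proof.
move=> symPsi; have [u [_ ZE Zmax]] := Z_spectral_max symPsi.
have Z_ge0 : 0 <= Z_spectral_radius Psi by rewrite -ZE.
set N := \sum_j _; have N_ge0 : 0 <= N by apply: sumr_ge0 => j _; exact: sqr_ge0.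
(* The zero vector cannot be normalized; the form vanishes there because the order [m.+1] is
   positive. *)
have [N0|N_neq0] := eqVneq N 0.
  have -> : w = 0 *: w.
    apply/colP => j; rewrite mxE mul0r; apply/eqP; rewrite -sqrf_eq0.
    move/eqP: N0; rewrite psumr_eq0 => [/allP/(_ j (mem_index_enum j))//|k _].
    exact: sqr_ge0.
  by rewrite tensor_formZ expr0n mul0r normr0 mulr_ge0 ?exprn_ge0 ?sqrtr_ge0.
set s := Num.sqrt N; have s_gt0 : 0 < s by rewrite sqrtr_gt0 lt_def N_neq0.
have /Zmax : (s^-1 *: w)^T *m (s^-1 *: w) = 1%:M.
  apply/unit_toC; rewrite sqnorm_toC; under eq_bigr do rewrite mxE exprMn.
  rewrite -mulr_sumr -/N -[X in _ * X](sqr_sqrtr N_ge0) -exprMn mulVf ?expr1n //.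
  by rewrite gt_eqF.
rewrite tensor_formZ normrM ger0_norm ?exprn_ge0 ?invr_ge0 ?(ltW s_gt0) //.
by rewrite exprVn mulrC ler_pdivrMr ?exprn_gt0.
Qed.

(** Where the form is negative at the real extremal point, multiplication by [om] reverses its sign
    without leaving the complex sphere. *)
Lemma Z_le_entanglement (R : realType) (m n : nat) (Psi : tensor R m.+1 n.+1) :
  tensor_symmetric Psi ->
  Z_spectral_radius Psi <= entanglement_eigenvalue (complex_tensor Psi).
Proof.
move=> symPsi; have [w [/unit_toC w1 <- _]] := Z_spectral_max symPsi.
have [_ [_ _ Qmax]] := entanglement_max symPsi.
have [F_ge0|F_lt0] := ger0P (tensor_form Psi w).
  by have := Qmax _ w1; rewrite tensor_form_toC.
pose om : R[i] := m.+1.-root (-1).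
have om1 : om ^+ m.+1 = -1 by rewrite rootCK.
have omN : `|om| = 1.
  by apply/eqP; rewrite -(@pexpr_eq1 _ _ m.+1) // -normrX om1 normrN1.
have := Qmax (om *: toC w); rewrite tensor_formZ om1 mulN1r tensor_form_toC; apply.
have := sqnormE (om *: toC w).
under eq_bigr => j _ do rewrite mxE normrM omN mul1r.
by rewrite -sqnormE w1 => -[].
Qed.

Lemma entanglement_eq (R : realType) (m n : nat) (Psi : tensor R m.+1 n.+1) :
  tensor_symmetric Psi ->
  (forall z, sqnorm z = 1 ->
     complex.Re (tensor_form (complex_tensor Psi) z) <= Z_spectral_radius Psi) ->
  entanglement_eigenvalue (complex_tensor Psi) = Z_spectral_radius Psi.
Proof.
move=> symPsi QleZ; apply/eqP; rewrite eq_le Z_le_entanglement // andbT.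
by have [z [z1 <- _]] := entanglement_max symPsi; exact: QleZ.
Qed.

(** * Equality for order two and for entries of constant sign *)

Lemma entanglement_eq_order2 (R : realType) (n : nat) (Psi : tensor R 2 n.+1) :
  tensor_symmetric Psi ->
  entanglement_eigenvalue (complex_tensor Psi) = Z_spectral_radius Psi.
Proof.
move=> symPsi; apply: entanglement_eq => // z z1.
pose x := map_mx (@complex.Re R) z; pose y := map_mx (@complex.Im R) z.
(* Mixed products of coordinates of [x] and [y] are purely imaginary contributions. *)
have -> : complex.Re (tensor_form (complex_tensor Psi) z) =
    tensor_form Psi x - tensor_form Psi y.
  rewrite complexRe_sum -sumrB; apply: eq_bigr => t _.
  case/tupleP: t => a t; case/tupleP: t => b t; rewrite (tuple0 t) /=.
  by rewrite complexReMl !big_cons !big_nil !mulr1 complexReM !mxE; ring.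
have bound (w : 'cV_n.+1) :
    `|tensor_form Psi w| <= Z_spectral_radius Psi * \sum_j w j 0 ^+ 2.
  have := normr_tensor_form_le w symPsi.
  by rewrite sqr_sqrtr // sumr_ge0 // => j _; exact: sqr_ge0.
have {}z1 : \sum_j x j 0 ^+ 2 + \sum_j y j 0 ^+ 2 = 1.
  by rewrite -big_split -z1; apply: eq_bigr => j _; rewrite !mxE.
have := bound x; have := bound y; rewrite !ler_norml => /andP[? _] /andP[_ ?].
by rewrite -[leRHS]mulr1 -z1; lra.
Qed.

Lemma Re_le_of_norm (R : rcfType) (x : R[i]) (a : R) :
  `|x| <= a%:C -> complex.Re x <= a.
Proof.
move=> xa; rewrite -lecR (le_trans _ xa) // (le_trans _ (normc_ge_Re x)) // lecR.
exact: ler_norm.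
Qed.

Lemma norm_tensor_form_le (R : realType) (m n : nat) (Psi : tensor R m n)
    (z : 'cV[R[i]]_n) :
  `|tensor_form (complex_tensor Psi) z| <=
     (tensor_form (fun t => `|Psi t|) (\col_j complex.Re `|z j 0|))%:C.
Proof.
rewrite -tensor_form_toC; apply: le_trans (ler_norm_sum _ _ _) _.
apply: ler_sum => t _; rewrite normrM normr_prod /complex_tensor.
rewrite normc_def /= expr0n addr0 sqrtr_sqr; rewrite le_eqVlt; apply/orP; left.
apply/eqP; congr (_ * _); apply: eq_bigr => j _; rewrite !mxE.
by rewrite normc_def; case: (z j 0).
Qed.

Lemma sqnorm_abs (R : realType) (n : nat) (z : 'cV[R[i]]_n) :
  \sum_j (\col_j complex.Re `|z j 0|) j 0 ^+ 2 = sqnorm z.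
Proof.
apply: eq_bigr => j _; rewrite mxE normc_def /= sqr_sqrtr //.
by rewrite addr_ge0 ?sqr_ge0.
Qed.

(** The triangle inequality discards all phases: [z] is replaced by the vector of its moduli, again
    of norm one, and each entry by its absolute value. *)
Lemma entanglement_eq_abs (R : realType) (m n : nat) (Psi : tensor R m.+1 n.+1) :
  tensor_symmetric Psi ->
  (forall r : 'cV[R]_n.+1, (forall j, 0 <= r j 0) -> \sum_j r j 0 ^+ 2 = 1 ->
     tensor_form (fun t => `|Psi t|) r <= Z_spectral_radius Psi) ->
  entanglement_eigenvalue (complex_tensor Psi) = Z_spectral_radius Psi.
Proof.
move=> symPsi absle; apply: entanglement_eq => // z z1; apply: Re_le_of_norm.
apply: le_trans (norm_tensor_form_le Psi z) _; rewrite lecR; apply: absle.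
  by move=> j; rewrite mxE normc_def /= sqrtr_ge0.
by rewrite sqnorm_abs.
Qed.

Lemma entanglement_eq_nonneg (R : realType) (m n : nat) (Psi : tensor R m.+1 n.+1) :
  tensor_symmetric Psi -> tensor_nonneg Psi ->
  entanglement_eigenvalue (complex_tensor Psi) = Z_spectral_radius Psi.
Proof.
move=> symPsi Psi_ge0; apply: entanglement_eq_abs => // r r_ge0 r1.
have -> : tensor_form (fun t => `|Psi t|) r = tensor_form Psi r.
  by apply: eq_bigr => t _; rewrite ger0_norm.
apply: le_trans (ler_norm _) _; apply: le_trans (normr_tensor_form_le r symPsi) _.
by rewrite r1 sqrtr1 expr1n mulr1.
Qed.

Lemma entanglement_eq_nonpos (R : realType) (m n : nat) (Psi : tensor R m.+1 n.+1) :
  tensor_symmetric Psi -> tensor_nonpos Psi ->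
  entanglement_eigenvalue (complex_tensor Psi) = Z_spectral_radius Psi.
Proof.
move=> symPsi Psi_le0; apply: entanglement_eq_abs => // r r_ge0 r1.
have -> : tensor_form (fun t => `|Psi t|) r = - tensor_form Psi r.
  by rewrite -tensor_form_opp; apply: eq_bigr => t _; rewrite ler0_norm.
apply: le_trans (ler_norm _) _; rewrite normrN.
apply: le_trans (normr_tensor_form_le r symPsi) _.
by rewrite r1 sqrtr1 expr1n mulr1.
Qed.

(** * Equality for orthogonally decomposable and diagonal tensors *)

(** Distributivity: an index tuple chooses one summand in each of the [m] factors. *)
Lemma sum_tuple_prod (K : comNzRingType) (m n : nat) (f : 'I_n -> K) :
  \sum_(t : m.-tuple 'I_n) \prod_(j <- t) f j = (\sum_j f j) ^+ m.
Proof.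
rewrite -[X in _ ^+ X]card_ord -prodr_const bigA_distr_bigA /=.
rewrite (reindex (fun g : {ffun 'I_m -> 'I_n} => [tuple g i | i < m])).
  apply: eq_bigr => g _; rewrite big_tuple; apply: eq_bigr => i _.
  by rewrite tnth_mktuple.
exists (fun t => [ffun i => tnth t i]) => [g|t] _.
  by apply/ffunP => i; rewrite ffunE tnth_mktuple.
by apply: eq_from_tnth => i; rewrite tnth_mktuple ffunE.
Qed.

(** A rank-one tensor contributes a power of a linear form. The ring is general because the formula
    is used over [R] and over [R[i]]. *)
Lemma tensor_form_rank_ones (K : comNzRingType) (m n p : nat) (Psi : tensor K m n)
    (alpha : 'I_p -> K) (y : 'I_p -> 'cV[K]_n) (z : 'cV[K]_n) :
  (forall t, Psi t = \sum_k alpha k * \prod_(j <- t) y k j 0) ->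
  tensor_form Psi z = \sum_k alpha k * (\sum_j y k j 0 * z j 0) ^+ m.
Proof.
move=> PsiE; rewrite /tensor_form; under eq_bigr => t _ do rewrite PsiE mulr_suml.
rewrite exchange_big; apply: eq_bigr => k _.
rewrite -sum_tuple_prod mulr_sumr; apply: eq_bigr => t _.
by rewrite big_split mulrA.
Qed.

Lemma orthonormal_dot (R : realType) (n : nat) (y : 'I_n -> 'cV[R]_n) k l :
  orthonormal_basis y -> \sum_j y k j 0 * y l j 0 = (k == l)%:R.
Proof.
move=> /(_ k l)/matrixP/(_ 0 0); rewrite !mxE mulr1n => <-.
by apply: eq_bigr => j _; rewrite mxE.
Qed.

(** Parseval's identity. Orthonormality says [Y *m Y^T = 1]; as [Y] is square, also [Y^T *m Y = 1],
    so the real matrix [Y] preserves the Hermitian norm. *)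
Lemma sqnorm_coords (R : realType) (n : nat) (y : 'I_n -> 'cV[R]_n)
    (z : 'cV[R[i]]_n) :
  orthonormal_basis y -> sqnorm z = 1 ->
  \sum_k `|\sum_j (y k j 0)%:C * z j 0| ^+ 2 = 1.
Proof.
move=> ony /sqnorm_unit z1; pose Y : 'M[R]_n := \matrix_(k, j) y k j 0.
have YT : Y^T *m Y = 1%:M.
  apply: mulmx1C; apply/matrixP => k l; rewrite !mxE -(orthonormal_dot k l ony).
  by apply: eq_bigr => j _; rewrite !mxE.
have /sqnorm_unit xi1 : (map_mx Num.conj (toC Y *m z))^T *m (toC Y *m z) = 1%:M.
  have YC : map_mx Num.conj (toC Y) = toC Y.
    by apply/matrixP => k j; rewrite !mxE; exact: conjc_real.
  rewrite map_mxM YC trmx_mul -mulmxA (mulmxA _ (toC Y)).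
  rewrite [(toC Y)^T]map_trmx -map_mxM YT.
  by rewrite map_mx1 mul1mx.
rewrite -[RHS](rmorph1 (real_complex R)) -xi1 /= sqnormE; apply: eq_bigr => k _.
by rewrite mxE; congr (`|_| ^+ 2); apply: eq_bigr => j _; rewrite !mxE.
Qed.

Lemma entanglement_eq_odeco (R : realType) (m n : nat) (Psi : tensor R m.+2 n.+1) :
  tensor_symmetric Psi -> orthogonally_decomposable Psi ->
  entanglement_eigenvalue (complex_tensor Psi) = Z_spectral_radius Psi.
Proof.
move=> symPsi [alpha [y [ony PsiE]]].
have [_ [_ _ Zmax]] := Z_spectral_max symPsi.
have alphaZ k : `|alpha k| <= Z_spectral_radius Psi.
  (* Each weight is the value of the form at a real unit vector, namely its own [y k]. *)
  have <- : tensor_form Psi (y k) = alpha k.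
    rewrite (tensor_form_rank_ones _ PsiE) (bigD1 k) //= orthonormal_dot // eqxx.
    rewrite expr1n mulr1 big1 ?addr0 // => l lk.
    by rewrite orthonormal_dot // (negbTE lk) expr0n mulr0.
  by apply: Zmax; rewrite ony eqxx.
apply: entanglement_eq => // z z1; apply: Re_le_of_norm.
have PsiCE t : complex_tensor Psi t =
    \sum_k (alpha k)%:C * \prod_(j <- t) toC (y k) j 0.
  rewrite /complex_tensor PsiE rmorph_sum; apply: eq_bigr => k _.
  rewrite rmorphM rmorph_prod; congr (_ * _).
  by apply: eq_bigr => j _; rewrite mxE.
rewrite (tensor_form_rank_ones _ PsiCE) -[leRHS]mulr1 -(sqnorm_coords ony z1) mulr_sumr.
apply: le_trans (ler_norm_sum _ _ _) _; apply: ler_sum => k _.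
have -> : \sum_j toC (y k) j 0 * z j 0 = \sum_j (y k j 0)%:C * z j 0.
  by apply: eq_bigr => j _; rewrite mxE.
have : `|\sum_j (y k j 0)%:C * z j 0| ^+ 2 <= 1.
  rewrite -(sqnorm_coords ony z1) [leRHS](bigD1 k) //= lerDl.
  by apply: sumr_ge0 => l _; exact: exprn_ge0.
set xi := `|_|; have xi_ge0 : 0 <= xi by exact: normr_ge0.
rewrite expr_le1 // => xi1.
rewrite normrM normrX -/xi; apply: ler_pM; rewrite ?exprn_ge0 //.
  by rewrite normc_def /= expr0n addr0 sqrtr_sqr lecR.
(* The order is at least two and [xi] is at most one, so the power of [xi] is bounded by [xi ^+ 2],
   the matching term of Parseval's sum. *)
by rewrite -addn2 exprD ler_piMl ?exprn_ile1 ?exprn_ge0.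
Qed.

Lemma odeco_of_diagonal (R : realType) (m n : nat) (Psi : tensor R m.+1 n) :
  tensor_diagonal Psi -> orthogonally_decomposable Psi.
Proof.
move=> diagPsi; exists (fun k => Psi [tuple of nseq m.+1 k]), (fun k => delta_mx k 0).
split=> [k l|t].
  apply/matrixP => i j; rewrite !ord1 !mxE mulr1n (bigD1 k) //= !mxE eqxx mul1r.
  by rewrite big1 ?addr0 ?andbT // => p pk; rewrite !mxE (negbTE pk) mul0r.
have [tc|tN] := boolP (constant t); last first.
  rewrite diagPsi // big1 // => k _; rewrite /rank_one.
  (* A nonconstant tuple has an index other than [k], at which the basis vector vanishes. *)
  have /allPn[i it ik] : ~~ all (pred1 k) t.
    apply: contra tN; case/tupleP: t => a t /= /andP[/eqP-> ].
    by rewrite /= => ->.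
  move: ik => /= /negbTE ik.
  by rewrite (big_rem i) //= mxE ik mul0r mulr0.
have tE : t = [tuple of nseq m.+1 (thead t)].
  apply: val_inj; case/tupleP: t tc => a t /= /all_pred1P; rewrite theadE size_tuple.
  by move=> ->.
rewrite {1}tE (bigD1 (thead t)) //= big1 => [|k kt].
  rewrite addr0 /rank_one big1_seq ?mulr1 // => i; rewrite {1}tE.
  by move=> /andP[_ /nseqP[-> _]]; rewrite mxE !eqxx.
rewrite /rank_one tE big_cons mxE; move: kt; rewrite eq_sym => /negbTE->.
by rewrite mul0r mulr0.
Qed.

(** * Equality for half-half supported, diagonally dominated tensors *)

(* Fixing the first index is what makes the count [C(m, h)] match the domination
   constant, here with tensor order [m.+1 = 2h]. *)
Definition head_split (m n h : nat) (j k : 'I_n) (t : m.+1.-tuple 'I_n) : bool :=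
  (thead t == j) && perm_eq t (nseq h j ++ nseq h k).

(** Such a tuple is determined by the set of positions holding [k]. This set has [h] elements and
    avoids the head, which leaves [m] available positions. *)
Lemma card_head_split (m n h : nat) (j k : 'I_n) :
  j != k ->
  (#|[set t : m.+1.-tuple 'I_n | head_split h j k t]| <= 'C(m, h))%N.
Proof.
move=> jk; pose pos (t : m.+1.-tuple 'I_n) := [set i | tnth t i == k].
have cm : #|[set~ ord0 : 'I_m.+1]| = m by rewrite cardsC1 card_ord.
have pos_inj : {in [set t | head_split h j k t] &, injective pos}.
  move=> t u; rewrite !inE => /andP[_ pt] /andP[_ pu] tu; apply: eq_from_tnth => i.
  have in2 (v : m.+1.-tuple 'I_n) : perm_eq v (nseq h j ++ nseq h k) ->
      tnth v i != k -> tnth v i = j.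
    move=> /perm_mem pv; have := mem_tnth i v; rewrite pv mem_cat !mem_nseq.
    by case/orP => /andP[_ /eqP->] //; rewrite eqxx.
  have := congr1 (fun A : {set 'I_m.+1} => i \in A) tu; rewrite !inE.
  have [-> /esym/eqP->//|tk uk] := eqVneq (tnth t i) k.
  by rewrite (in2 t) // (in2 u) // -uk.
rewrite -[X in 'C(X, _)]cm -cards_draws -(card_in_imset pos_inj).
apply/subset_leq_card/fintype.subsetP => A /imsetP[t].
rewrite inE => /andP[/eqP tj pt] ->.
rewrite inE; apply/andP; split.
  apply/fintype.subsetP => i; rewrite !inE; apply: contraTneq => ->.
  by rewrite -/(thead t) tj.
have -> : #|pos t| = count_mem k t.
  by rewrite -sum1_card -sum1_count big_tuple; apply: eq_bigl => i; rewrite inE.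
by rewrite (elimT seq.permP pt) count_cat !count_nseq /= eqxx (negbTE jk) mul0n mul1n.
Qed.

(** Each [r j] is at most one, so passing from exponent two to [h] cannot increase any term. *)
Lemma sum_half_powers_le1 (R : realFieldType) (n h : nat) (r : 'I_n -> R) :
  (1 < h)%N -> (forall j, 0 <= r j) -> \sum_j r j ^+ 2 = 1 ->
  \sum_j r j ^+ h <= 1.
Proof.
case: h => [|[|h]] // _ r_ge0 r1; rewrite -[leRHS]r1; apply: ler_sum => j _.
rewrite -addn2 exprD ler_piMl ?exprn_ge0 ?exprn_ile1 // -(@expr_le1 _ 2) //.
rewrite -r1 (bigD1 j) //= lerDl; apply: sumr_ge0 => k _; exact: sqr_ge0.
Qed.

(** A diagonal entry is the value of the form at a standard basis vector. *)
Lemma diagonal_entry_le (R : realType) (m n : nat) (Psi : tensor R m.+1 n.+1)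
    (j : 'I_n.+1) :
  tensor_symmetric Psi ->
  `|Psi [tuple of nseq m.+1 j]| <= Z_spectral_radius Psi.
Proof.
move=> symPsi; have [_ [_ _ Zmax]] := Z_spectral_max symPsi.
have <- : tensor_form Psi (delta_mx j 0) = Psi [tuple of nseq m.+1 j].
  rewrite /tensor_form (bigD1 [tuple of nseq m.+1 j]) // [X in _ * X]big1_seq => [|i].
    rewrite mulr1 big1 /= ?addr0 // => t tj.
    have /allPn[i it /= /negbTE ij] : ~~ all (pred1 j) t.
      apply: contra tj => /all_pred1P; rewrite size_tuple => tE.
      exact/eqP/val_inj.
    by rewrite (big_rem i) //= mxE ij mul0r mulr0.
  by move=> /andP[_ /nseqP[-> _]]; rewrite mxE !eqxx.
apply: Zmax; apply/matrixP => i k; rewrite !ord1 !mxE mulr1n (bigD1 j) //=.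
by rewrite !mxE eqxx mul1r big1 ?addr0 // => p pj; rewrite !mxE (negbTE pj) mul0r.
Qed.

(** For [j = k] only the constant tuple occurs. Otherwise there are at most ['C(m, h)] tuples, and
    domination bounds ['C(m, h)] times each entry by a diagonal one. *)
Lemma head_split_sum_le (R : realType) (m n h : nat) (Psi : tensor R m.+1 n.+1)
    (j k : 'I_n.+1) :
  tensor_symmetric Psi -> m.+1 = (h + h)%N -> (0 < h)%N ->
  (forall (j : 'I_n.+1) (t : m.+1.-tuple 'I_n.+1), ~~ constant t -> j \in t ->
    'C(m, h)%:R * `|Psi t| <= `|Psi [tuple of nseq m.+1 j]|) ->
  \sum_(t | head_split h j k t) `|Psi t| <= Z_spectral_radius Psi.
Proof.
move=> symPsi mE h_gt0 dom.
have [<-|jk] := eqVneq j k.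
  apply: le_trans (diagonal_entry_le j symPsi).
  rewrite (bigD1 [tuple of nseq m.+1 j]) /=; last first.
    by rewrite /head_split -nseqD -mE perm_refl andbT.
  rewrite big1 ?addr0 // => t /andP[/andP[_ pt] /negP[]].
  apply/eqP/val_inj; rewrite /= -[RHS]/(nseq m.+1 j) -[in RHS](size_tuple t).
  by apply/all_pred1P; rewrite (perm_all _ pt) -nseqD all_pred1_nseq.
have C_gt0 : 0 < 'C(m, h)%:R :> R by rewrite ltr0n bin_gt0 -ltnS mE -addn1 leq_add2l.
rewrite -(ler_pM2l C_gt0) mulr_sumr.
apply: (@le_trans _ _ (\sum_(t | head_split (m := m) h j k t) Z_spectral_radius Psi)).
  apply: ler_sum => t /andP[/eqP tj pt].
  have kt : k \in t by rewrite (perm_mem pt) mem_cat !mem_nseq h_gt0 eqxx orbT.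
  apply: le_trans (diagonal_entry_le k symPsi); apply: dom => //.
  (* The tuple is not constant, since its head is [j] and it also contains [k]. *)
  apply: contraNN jk; rewrite eq_sym; case/tupleP: t tj kt {pt} => a t.
  rewrite theadE => ->; rewrite in_cons => /orP[//|kt] /= /allP tc.
  exact: tc.
have Z_ge0 := le_trans (normr_ge0 _) (diagonal_entry_le j symPsi).
rewrite sumr_const -[leLHS]mulr_natl ler_wpM2r // ler_nat.
by apply: leq_trans (card_head_split m h jk); rewrite cardsE.
Qed.

Lemma entanglement_eq_half_half (R : realType) (m n : nat) (Psi : tensor R m.+1 n.+1) :
  tensor_symmetric Psi -> (4 <= m.+1)%N -> ~~ odd m.+1 ->
  half_half_supported Psi -> diagonally_dominated Psi ->
  entanglement_eigenvalue (complex_tensor Psi) = Z_spectral_radius Psi.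
Proof.
move=> symPsi m_ge4 m_even; rewrite /half_half_supported /diagonally_dominated.
set h := m.+1./2; rewrite [m.+1.-1]/= => supp dom.
have mE : m.+1 = (h + h)%N by rewrite addnn -[LHS]odd_double_half (negbTE m_even).
have h_gt1 : (1 < h)%N by exact: (half_leq m_ge4).
apply: entanglement_eq_abs => // r r_ge0 r1.
have prod_ge0 (t : m.+1.-tuple 'I_n.+1) : 0 <= \prod_(j <- t) r j 0.
  by apply: prodr_ge0 => j _.
have Z_ge0 : 0 <= Z_spectral_radius Psi by exact: le_trans (diagonal_entry_le 0 symPsi).
(* Every nonzero entry is counted at least once, under its first index and the other index; all
   terms are nonnegative, so overcounting is harmless. *)
apply: (@le_trans _ _ (\sum_j \sum_k \sum_(t : m.+1.-tuple 'I_n.+1 | head_split h j k t)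
    `|Psi t| * \prod_(j <- t) r j 0)).
  rewrite pair_big /=; under [leRHS]eq_bigr do rewrite big_mkcond.
  rewrite exchange_big; apply: ler_sum => t _ /=.
  have w_ge0 (b : bool) : 0 <= if b then `|Psi t| * \prod_(j <- t) r j 0 else 0.
    by case: b; rewrite // mulr_ge0.
  have [t0|/supp[j [k pt]]] := eqVneq (Psi t) 0.
    by rewrite {1}t0 normr0 mul0r sumr_ge0.
  have [p pP] : exists p, head_split h p.1 p.2 t.
    have : thead t \in nseq h j ++ nseq h k by rewrite -(perm_mem pt) mem_tnth.
    rewrite mem_cat !mem_nseq => /orP[]/andP[_ /eqP tE].
      by exists (j, k); rewrite /head_split tE eqxx.
    by exists (k, j); rewrite /head_split tE eqxx perm_sym perm_catC perm_sym.
  by rewrite (bigD1 p) //= pP lerDl sumr_ge0.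
(* For a tuple split between [j] and [k] the monomial is [r j 0 ^+ h * r k 0 ^+ h], so the double
   sum factors into a square. *)
apply: (@le_trans _ _ (Z_spectral_radius Psi * (\sum_j r j 0 ^+ h) ^+ 2)).
  rewrite expr2 mulr_suml mulr_sumr; apply: ler_sum => j _.
  rewrite !mulr_sumr; apply: ler_sum => k _.
  have rjk_ge0 : 0 <= r j 0 ^+ h * r k 0 ^+ h by rewrite mulr_ge0 ?exprn_ge0.
  have jk_le := head_split_sum_le j k symPsi mE (ltnW h_gt1) dom.
  apply: le_trans (ler_wpM2r rjk_ge0 jk_le).
  rewrite mulr_suml; apply: ler_sum => t /andP[_ pt].
  by rewrite (perm_big _ pt) big_cat !big_nseq !iter_mulr_1.
have S_ge0 : 0 <= \sum_j r j 0 ^+ h by apply: sumr_ge0 => j _; exact: exprn_ge0.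
rewrite ler_piMr // exprn_ile1 //; exact: sum_half_powers_le1.
Qed.

Theorem theorem3p1 (R : realType) (m n : nat) (hm : (2 <= m)%N) (hn : (2 <= n)%N)
    (Psi : tensor R m n) (hPsi : tensor_symmetric Psi) :
  Z_spectral_radius Psi <= entanglement_eigenvalue (complex_tensor Psi)
  /\
  (m = 2%N
   \/ tensor_diagonal Psi
   \/ tensor_nonneg Psi
   \/ tensor_nonpos Psi
   \/ orthogonally_decomposable Psi
   \/ ((4 <= m)%N /\ ~~ odd m /\
       half_half_supported Psi /\ diagonally_dominated Psi) ->
   entanglement_eigenvalue (complex_tensor Psi) = Z_spectral_radius Psi).
Proof.
(* Positive dimension makes the unit spheres nonempty, and the order takes the form [m.+2] used in
   the decomposable case. *)
case: m n hm hn Psi hPsi => [|[|m]] [|n] // _ _ Psi hPsi.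
split; first exact: Z_le_entanglement.
case=> [m2|[|[|[|[|]]]]].
- by case: m2 Psi hPsi => -> Psi hPsi; exact: entanglement_eq_order2.
- by move=> diag; apply: entanglement_eq_odeco => //; exact: odeco_of_diagonal.
- exact: entanglement_eq_nonneg.
- exact: entanglement_eq_nonpos.
- exact: entanglement_eq_odeco.
- by case=> m_ge4 [m_even [supp dom]]; exact: entanglement_eq_half_half.
Qed.
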